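(* Let $\mathcal{H}$ be a Hilbert space of finite dimension $D$, let $\epsilon\ge0$ and $\kappa\ge0$, and declare two states on $\mathcal{H}$ neighbouring, $\rho\sim\sigma$, if $\frac12\|\rho-\sigma\|_1\le\kappa$. For $0\le p\le1$ let $\mathcal{D}_p(\rho)=(1-p)\rho+p\frac{I}{D}$ be the depolarizing channel on $\mathcal{H}$. Then: (1) $\mathcal{D}_p$ is $(\epsilon,\delta)$-differentially private with $$\delta=\max\Big\{0,(1-e^\epsilon)\frac pD+(1-p)\kappa\Big\}.$$ (2) Let $\mathcal{A}=(\mathcal{D}_{p_n}\circ\mathcal{C}_n)\circ\cdots\circ(\mathcal{D}_{p_1}\circ\mathcal{C}_1)$ with $\mathcal{C}_1,\dots,\mathcal{C}_n$ quantum channels on $\mathcal{H}$ and $0\le p_i\le1$. Then $\mathcal{A}$ is $(\epsilon,\delta)$-differentially private with $$\delta=\max\Big\{0,(1-e^\epsilon)\frac{p_\star}{D}+(1-p_\star)\kappa\Big\},\qquad p_\star=1-\prod_{i=1}^n(1-p_i).$$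
   Context: A quantum channel is a completely positive trace-preserving map ($\mathcal{D}_p$ is extended linearly as $X\mapsto(1-p)X+p\operatorname{Tr}(X)I/D$). A channel $\mathcal{A}$ is $(\epsilon,\delta)$-differentially private if for all operators $0\le M\le I$ and all quantum states $\rho\sim\sigma$, $\operatorname{Tr}(M\mathcal{A}(\rho))\le e^\epsilon\operatorname{Tr}(M\mathcal{A}(\sigma))+\delta$. *)

(* Defs.v *)
From HB Require Import structures.
From mathcomp Require Import all_boot all_order all_algebra.
From mathcomp Require Import spectral complex.
From mathcomp Require Import reals sequences exp.

Set Implicit Arguments.
Unset Strict Implicit.
Unset Printing Implicit Defensive.

Import Order.TTheory GRing.Theory Num.Theory.

Local Open Scope ring_scope.
Local Open Scope complex_scope.
Local Open Scope sesquilinear_scope.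

(* The Hilbert space of dimension D is R[i]^D, R the real numbers; its operators
   are the D x D matrices, and A ^t* is the adjoint of A.                     *)

Section Operators.
Variables (R : realType).
Local Notation C := R[i].

(* In R[i], 0 <= z means that z is real and nonnegative, so this condition
   already forces A to be Hermitian.                                          *)
Definition psd n (A : 'M[C]_n) : Prop :=
  forall v : 'cV[C]_n, 0 <= (v ^t* *m A *m v) 0 0.

(* The Loewner order. *)
Definition loewner_le n (A B : 'M[C]_n) : Prop := psd (B - A).

(* Spectral functional calculus: A = P^-1 diag(d) P with P := spectralmx A unitary
   whenever A is normal. It is only used below on the psd matrix A^* A.       *)
Definition sqrtmx n (A : 'M[C]_n) : 'M[C]_n :=
  invmx (spectralmx A) *m diag_mx (map_mx sqrtC (spectral_diag A))
    *m spectralmx A.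

(* ||A||_1 = Tr sqrt(A^* A), a (nonnegative real) element of R[i]. *)
Definition trace_norm n (A : 'M[C]_n) : C := \tr (sqrtmx (A ^t* *m A)).

Definition state n (rho : 'M[C]_n) : Prop := psd rho /\ \tr rho = 1.

Definition neighbouring (kappa : R) n (rho sigma : 'M[C]_n) : Prop :=
  2^-1 * trace_norm (rho - sigma) <= kappa%:C.

(* id_k (x) Phi, an operator on C^k (x) C^n being a k x k matrix of n x n blocks. *)
Definition ampliation k n (Phi : 'M[C]_n -> 'M[C]_n)
    (X : 'M[C]_(\sum_(i < k) n)) : 'M[C]_(\sum_(i < k) n) :=
  \mxblock_(i < k, j < k) Phi (submxblock X i j).

Definition completely_positive n (Phi : 'M[C]_n -> 'M[C]_n) : Prop :=
  forall k (X : 'M[C]_(\sum_(i < k) n)), psd X -> psd (ampliation Phi X).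

Definition trace_preserving n (Phi : 'M[C]_n -> 'M[C]_n) : Prop :=
  forall X, \tr (Phi X) = \tr X.

Definition channel n (Phi : 'M[C]_n -> 'M[C]_n) : Prop :=
  [/\ linear Phi, completely_positive Phi & trace_preserving Phi].

(* Differential privacy is a property of channels, hence the first conjunct.
   The traces are real, and the inequality in R[i] is the one between reals.  *)
Definition differentially_private n (nb : 'M[C]_n -> 'M[C]_n -> Prop)
    (eps delta : R) (Phi : 'M[C]_n -> 'M[C]_n) : Prop :=
  channel Phi /\
  forall M rho sigma : 'M[C]_n,
    loewner_le 0 M -> loewner_le M 1%:M ->
    state rho -> state sigma -> nb rho sigma ->
    \tr (M *m Phi rho) <= (expR eps)%:C * \tr (M *m Phi sigma) + delta%:C.

Definition depolarizing n (p : R) (X : 'M[C]_n) : 'M[C]_n :=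
  (1 - p)%:C *: X + (p%:C * \tr X) *: (n%:R^-1)%:M.

(* (D_{p_n} o C_n) o ... o (D_{p_1} o C_1); index 0 is applied first. *)
Definition noisy_circuit D n (Cs : 'I_n -> 'M[C]_D -> 'M[C]_D) (p : 'I_n -> R)
    (X : 'M[C]_D) : 'M[C]_D :=
  foldl (fun Y i => depolarizing (p i) (Cs i Y)) X (enum 'I_n).

End Operators.

(* Main.v *)
(* A depolarized circuit has the form X |-> (1 - p) Psi X + Tr X tau with Psi a
   channel and tau >= (p / D) Psi w for every state w: pushing such a form through a
   channel preserves the domination, and each depolarization adds a multiple of
   I / D >= Psi w / D, so that the 1 - p multiply.
   With rho - sigma = P - N the Jordan decomposition, T := Tr P = ||rho - sigma||_1 / 2
   <= kappa, and q := Tr (M Psi (P / T)) in [0, 1], the privacy loss is at most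
   (1 - p) Tr (M Psi P) + (1 - e^eps) Tr (M tau)
     <= q ((1 - p) kappa + (1 - e^eps) p / D). *)
From HB Require Import structures.
Require Import Defs.
From mathcomp Require Import all_boot all_order all_algebra.
From mathcomp Require Import spectral.
From mathcomp Require Import complex boolp reals sequences exp.
From mathcomp Require Import ring lra.

Set Implicit Arguments.
Unset Strict Implicit.
Unset Printing Implicit Defensive.

Import Order.TTheory GRing.Theory Num.Theory.
Local Open Scope ring_scope.

(** * Positive semidefinite matrices and spectral decomposition *)

Section PositiveSemidefinite.
Local Open Scope sesquilinear_scope.
Variable R : realType.
Local Notation C := R[i].

Lemma adjmx_mul m n p (A : 'M[C]_(m, n)) (B : 'M_(n, p)) :
  (A *m B) ^t* = B ^t* *m A ^t*.
Proof. by rewrite trmx_mul map_mxM. Qed.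

Lemma psd0 n : psd (0 : 'M[C]_n).
Proof. by move=> v; rewrite mulmx0 mul0mx mxE. Qed.

Lemma psdD n (A B : 'M[C]_n) : psd A -> psd B -> psd (A + B).
Proof. by move=> pA pB v; rewrite mulmxDr mulmxDl mxE addr_ge0. Qed.

Lemma psdZ n (a : C) (A : 'M[C]_n) : 0 <= a -> psd A -> psd (a *: A).
Proof. by move=> a0 pA v; rewrite -scalemxAr -scalemxAl mxE mulr_ge0. Qed.

Lemma psd_congr m n (A : 'M[C]_n) (B : 'M[C]_(n, m)) :
  psd A -> psd (B ^t* *m A *m B).
Proof. by move=> pA v; have := pA (B *m v); rewrite adjmx_mul !mulmxA. Qed.

Lemma psd_diag_mx n (d : 'rV[C]_n) : (forall i, 0 <= d 0 i) -> psd (diag_mx d).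
Proof.
move=> d0 v; rewrite mul_mx_diag mxE sumr_ge0 // => i _.
by rewrite !mxE mulrAC mulr_ge0 // mulrC mul_conjC_ge0.
Qed.

Lemma psd_diag_ge0 n (A : 'M[C]_n) i : psd A -> 0 <= A i i.
Proof.
move=> /(_ (delta_mx i 0)); rewrite trmx_delta map_delta_mx -rowE -colE.
by rewrite !mxE.
Qed.

Lemma psd_tr_ge0 n (A : 'M[C]_n) : psd A -> 0 <= \tr A.
Proof. by move=> pA; apply: sumr_ge0 => i _; exact: psd_diag_ge0. Qed.

(** Polarization: vanishing on the diagonal makes the sesquilinear form antisymmetric, and replacing
    [v] by ['i *: v] turns this into symmetry, so the form is zero. *)
Lemma quadratic_form_eq0 n (B : 'M[C]_n) :
  (forall v : 'cV_n, (v ^t* *m B *m v) 0 0 = 0) -> B = 0.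
Proof.
move=> qB; pose f (u v : 'cV_n) := (u ^t* *m B *m v) 0 0.
have fDl u u' v : f (u + u') v = f u v + f u' v.
  by rewrite /f linearD /= map_mxD !mulmxDl mxE.
have fDr u v v' : f u (v + v') = f u v + f u v' by rewrite /f mulmxDr mxE.
have fZl a u v : f (a *: u) v = a^* * f u v.
  by rewrite /f linearZ /= map_mxZ -!scalemxAl mxE.
have fZr a u v : f u (a *: v) = a * f u v by rewrite /f -scalemxAr mxE.
have f0 v : f v v = 0 by exact: qB.
have fC u v : f u v = - f v u.
  by apply/eqP; rewrite -addr_eq0; have := f0 (u + v); rewrite fDl !fDr !f0 add0r addr0 => ->.
have fuv u v : f u v = 0.
  have := fC u ('i *: v); rewrite fZl fZr conjCi mulNr opprK [f v u]fC mulrN.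
  move/eqP; rewrite -subr_eq0 opprK -mulr2n mulrn_eq0 mulf_eq0 (negPf (neq0Ci _)).
  by move/eqP.
apply/matrixP => i j; have := fuv (delta_mx i 0) (delta_mx j 0).
by rewrite /f trmx_delta map_delta_mx -rowE -colE !mxE.
Qed.

Lemma psd_adj n (A : 'M[C]_n) : psd A -> A ^t* = A.
Proof.
move=> pA; apply/eqP; rewrite -subr_eq0; apply/eqP/quadratic_form_eq0 => v.
rewrite mulmxBr mulmxBl mxE [X in _ + X]mxE; apply/eqP; rewrite subr_eq0; apply/eqP.
have -> : v ^t* *m A ^t* *m v = (v ^t* *m A *m v) ^t*.
  by rewrite !adjmx_mul trmxCK mulmxA.
by rewrite !mxE; apply/CrealP; apply: ger0_real; have := pA v; rewrite mxE.
Qed.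

Lemma adj_spectral n (A : 'M[C]_n) : A ^t* = A ->
  exists (U : 'M[C]_n) (d : 'rV[C]_n), [/\ U \is unitarymx, (forall i, d 0 i \is Num.real)
                & A = U ^t* *m diag_mx d *m U].
Proof.
move=> hA; have hermA : A \is hermsymmx by apply/is_hermitianmxP; rewrite scale1r hA.
exists (spectralmx A), (spectral_diag A); split.
- exact: spectral_unitarymx.
- by move=> i; have /mxOverP := hermitian_spectral_diag_real hermA; apply.
- rewrite -invmx_unitary ?spectral_unitarymx //.
  exact/orthomx_spectralP/hermitian_normalmx.
Qed.

Lemma unitary_conjK n (U A : 'M[C]_n) : U \is unitarymx ->
  U *m (U ^t* *m A *m U) *m U ^t* = A.
Proof.
by move=> /unitarymxP UU; rewrite !mulmxA UU mul1mx -mulmxA UU mulmx1.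
Qed.

Lemma mxtrace_unitary_conj n (U A : 'M[C]_n) : U \is unitarymx ->
  \tr (U ^t* *m A *m U) = \tr A.
Proof. by move=> /unitarymxP UU; rewrite mxtrace_mulC mulmxA UU mul1mx. Qed.

Lemma psd_spectral n (A : 'M[C]_n) : psd A ->
  exists (U : 'M[C]_n) (d : 'rV[C]_n), [/\ U \is unitarymx, (forall i, 0 <= d 0 i)
                & A = U ^t* *m diag_mx d *m U].
Proof.
move=> pA; have [U [d [uU _ eA]]] := adj_spectral (psd_adj pA).
exists U, d; split=> // i.
have := psd_congr (U ^t*) pA; rewrite trmxCK eA unitary_conjK //.
by move/(@psd_diag_ge0 _ _ i); rewrite mxE eqxx.
Qed.

(** Diagonalizing [B] by [U] turns the trace into the sum of the eigenvalues of [B] times the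
    diagonal entries of [U A U^*], all nonnegative. *)
Lemma psd_tr_mul_ge0 n (A B : 'M[C]_n) : psd A -> psd B -> 0 <= \tr (A *m B).
Proof.
move=> pA /psd_spectral[U [d [uU d0 ->]]].
rewrite !mulmxA mxtrace_mulC !mulmxA mul_mx_diag sumr_ge0 // => i _.
rewrite mxE mulr_ge0 //; apply: psd_diag_ge0.
by have := psd_congr (U ^t*) pA; rewrite trmxCK.
Qed.

(** Each eigenvalue is at most the sum of all of them. This is where [I] dominates [Psi w] for a
    state [w]. *)
Lemma psd_le_mxtrace n (A : 'M[C]_n) : psd A -> psd ((\tr A)%:M - A).
Proof.
move=> pA; have [U [d [uU d0 eA]]] := psd_spectral pA.
have -> : (\tr A)%:M - A = U ^t* *m diag_mx (const_mx (\tr A) - d) *m U.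
  rewrite linearB /= diag_const_mx mulmxBr mulmxBl -eA mul_mx_scalar -scalemxAl.
  have /unitarymxP : U ^t* \is unitarymx by rewrite trmxC_unitary.
  by rewrite trmxCK => ->; rewrite scalemx1.
apply/psd_congr/psd_diag_mx => i; rewrite !mxE subr_ge0 eA.
by rewrite mxtrace_unitary_conj // mxtrace_diag (bigD1 i) //= lerDl sumr_ge0.
Qed.

(** * Trace norm and Jordan decomposition *)

Lemma char_poly_conj (F : comUnitRingType) n (U A : 'M[F]_n) : U \in unitmx ->
  char_poly (invmx U *m A *m U) = char_poly A.
Proof.
move=> uU; rewrite /char_poly /char_poly_mx !map_mxM.
have VU : map_mx polyC (invmx U) *m map_mx polyC U = 1%:M.
  by rewrite -map_mxM mulVmx // map_mx1.
have {1}-> : 'X%:M = map_mx polyC (invmx U) *m 'X%:M *m map_mx polyC U.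
  by rewrite mul_mx_scalar -scalemxAl VU scalemx1.
rewrite -mulmxBl -mulmxBr !det_mulmx mulrC mulrA -det_mulmx.
by rewrite (mulmx1C VU) det1 mul1r.
Qed.

(** The trace norm is computed in the eigenbasis chosen by [spectralmx], unrelated to [U]. Both
    diagonalizations of [A^* A] have the same characteristic polynomial, so their eigenvalues agree
    up to order, and so do the sums of square roots. *)
Lemma trace_normE n (U : 'M[C]_n) (d : 'rV[C]_n) : U \is unitarymx ->
  trace_norm (U ^t* *m diag_mx d *m U) = \sum_i `|d 0 i|.
Proof.
move=> uU; set A := _ *m U.
pose e := \row_i (`|d 0 i| ^+ 2).
have eAA : A ^t* *m A = U ^t* *m diag_mx e *m U.
  rewrite /A !adjmx_mul trmxCK !mulmxA; congr (_ *m U).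
  rewrite -2!mulmxA [U *m _]mulmxA (unitarymxP uU) mul1mx -mulmxA; congr (_ *m _).
  rewrite tr_diag_mx map_diag_mx mulmx_diag; congr diag_mx.
  by apply/rowP => i; rewrite !mxE normCK mulrC.
clearbody A; have nAA : A ^t* *m A \is normalmx.
  by apply/normalmxP; rewrite adjmx_mul trmxCK.
rewrite /trace_norm /sqrtmx; set B := A ^t* *m A in eAA nAA *.
have uV := spectral_unitarymx B.
have eB := orthomx_spectralP nAA.
rewrite invmx_unitary // in eB *.
rewrite mxtrace_unitary_conj // mxtrace_diag.
have char_conj (W : 'M[C]_n) (f : 'rV[C]_n) : W \is unitarymx ->
    char_poly (W ^t* *m diag_mx f *m W) = \prod_(x <- [seq f 0 i | i : 'I_n]) ('X - x%:P).
  move=> uW; rewrite -invmx_unitary //.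
  rewrite char_poly_conj ?unitarymx_unit // char_poly_trig ?diag_mx_is_trig // big_image /=.
  by apply: eq_bigr => i _; rewrite mxE eqxx.
have pe : perm_eq [seq spectral_diag B 0 i | i : 'I_n] [seq e 0 i | i : 'I_n].
  by apply: prod_XsubC_eq; rewrite -(char_conj _ _ uV) -(char_conj _ _ uU) -eB -eAA.
transitivity (\sum_(x <- [seq spectral_diag B 0 i | i : 'I_n]) sqrtC x).
  by rewrite big_image /=; apply: eq_bigr => i _; rewrite mxE.
rewrite (perm_big _ pe) big_image /=; apply: eq_bigr => i _.
by rewrite mxE sqrCK.
Qed.

(** [P] is the positive part of [H], with eigenvalues [(|d| + d) / 2]; then [P - H] is the negative
    part, with eigenvalues [(|d| - d) / 2]. *)
Lemma psd_jordan n (H : 'M[C]_n) : H ^t* = H ->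
  exists P, [/\ psd P, psd (P - H) & \tr P = 2^-1 * (trace_norm H + \tr H)].
Proof.
move=> /adj_spectral[U [d [uU dr eH]]].
exists (U ^t* *m diag_mx (\row_i (2^-1 * (`|d 0 i| + d 0 i))) *m U); split.
- apply/psd_congr/psd_diag_mx => i; rewrite mxE mulr_ge0 ?invr_ge0 ?ler0n //.
  by rewrite -lerBlDl sub0r lerNl -normrN real_ler_norm ?realN.
- rewrite eH -mulmxBl -mulmxBr -linearB /=.
  apply/psd_congr/psd_diag_mx => i; rewrite !mxE.
  have -> : 2^-1 * (`|d 0 i| + d 0 i) - d 0 i = 2^-1 * (`|d 0 i| - d 0 i) by field.
  by rewrite mulr_ge0 ?invr_ge0 ?ler0n // subr_ge0 real_ler_norm.
- rewrite eH trace_normE // !mxtrace_unitary_conj // !mxtrace_diag -big_split mulr_sumr /=.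
  by apply: eq_bigr => i _; rewrite mxE.
Qed.

End PositiveSemidefinite.

(** * Block matrices and complete positivity *)

Section Channels.
Local Open Scope sesquilinear_scope.
Local Open Scope complex_scope.
Variable R : realType.
Local Notation C := R[i].

Lemma psd_mxblockP k n (B : 'I_k -> 'I_k -> 'M[C]_n) :
  psd (\mxblock_(i < k, j < k) B i j) <->
  forall w : 'I_k -> 'cV[C]_n,
    0 <= \sum_i \sum_j ((w i) ^t* *m B i j *m w j) 0 0.
Proof.
have qf (w : 'I_k -> 'cV[C]_n) :
    ((\mxcol_i w i) ^t* *m (\mxblock_(i, j) B i j) *m \mxcol_i w i) 0 0 =
    \sum_i \sum_j ((w i) ^t* *m B i j *m w j) 0 0.
  rewrite tr_mxcol.
  have -> : (\mxrow_i (w i)^T) ^ Num.conj = \mxrow_i (w i) ^t*.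
    by apply/matrixP => i j; rewrite !mxE.
  rewrite mul_mxrow_mxblock mul_mxrow_mxcol summxE exchange_big /=.
  by apply: eq_bigr => j _; rewrite mulmx_suml summxE.
split=> [pB w|pB v]; first by rewrite -qf.
by rewrite -(submxcolK v) qf.
Qed.

Lemma completely_positive_psd n (Phi : 'M[C]_n -> 'M[C]_n) X :
  completely_positive Phi -> psd X -> psd (Phi X).
Proof.
move=> cpPhi pX.
(* Positivity is complete positivity with a single block. *)
have : psd (\mxblock_(i < 1, j < 1) X).
  by apply/psd_mxblockP => w; rewrite !big_ord1.
move/cpPhi; rewrite /ampliation => /psd_mxblockP pPhi v.
have := pPhi (fun=> v); rewrite !big_ord1.
by rewrite mxblockK.
Qed.

Lemma completely_positive_comp n (Phi Psi : 'M[C]_n -> 'M[C]_n) :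
  completely_positive Phi -> completely_positive Psi ->
  completely_positive (Phi \o Psi).
Proof.
move=> cPhi cPsi k X /cPsi/cPhi; rewrite /ampliation.
by congr psd; apply: eq_mxblock => i j; rewrite mxblockK.
Qed.

Lemma channel_id n : channel (@id 'M[C]_n).
Proof.
by split=> [//|k X pX|//]; rewrite /ampliation submxblockK.
Qed.

Lemma channel_comp n (Phi Psi : 'M[C]_n -> 'M[C]_n) :
  channel Phi -> channel Psi -> channel (Phi \o Psi).
Proof.
move=> [lPhi cPhi tPhi] [lPsi cPsi tPsi]; split.
- by move=> a X Y /=; rewrite lPsi lPhi.
- exact: completely_positive_comp.
- by move=> X /=; rewrite tPhi tPsi.
Qed.

(* The quadratic form at [w] is the sum over [a] and [b] of that of [B] at the block
   vectors with blocks [w i a *: e_b]. *)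
Lemma psd_mxblock_tr k n (B : 'I_k -> 'I_k -> 'M[C]_n) :
  psd (\mxblock_(i < k, j < k) B i j) ->
  psd (\mxblock_(i < k, j < k) ((\tr (B i j))%:M : 'M[C]_n)).
Proof.
move=> /psd_mxblockP pB; apply/psd_mxblockP => w.
suff -> : \sum_i \sum_j ((w i) ^t* *m (\tr (B i j))%:M *m w j) 0 0 =
    \sum_(a < n) \sum_(b < n) \sum_i \sum_j
      ((w i a 0 *: (delta_mx b 0 : 'cV_n)) ^t* *m B i j
         *m (w j a 0 *: (delta_mx b 0 : 'cV_n))) 0 0.
  by rewrite sumr_ge0 // => a _; rewrite sumr_ge0.
under [RHS]eq_bigr do rewrite exchange_big.
rewrite [RHS]exchange_big; apply: eq_bigr => i _.
under [RHS]eq_bigr do rewrite exchange_big.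
rewrite [RHS]exchange_big; apply: eq_bigr => j _.
rewrite mul_mx_scalar -scalemxAl mxE [X in _ * X]mxE mulr_sumr.
apply: eq_bigr => a _.
rewrite /mxtrace mulr_suml; apply: eq_bigr => b _.
rewrite [(_ *: _)^T]linearZ /= map_mxZ trmx_delta map_delta_mx -scalemxAr -!scalemxAl.
rewrite -rowE -colE !mxE; ring.
Qed.

Lemma mxtraceB n (A B : 'M[C]_n) : \tr (A - B) = \tr A - \tr B.
Proof. exact: raddfB. Qed.

(** Linearity is only a proposition inside [channel]; packing [f] as a linear map yields the
    morphism laws as rewrite rules. *)
Lemma linear_morph (V : lmodType C) (f : V -> V) : linear f ->
  (forall X Y, f (X - Y) = f X - f Y) * (forall X Y, f (X + Y) = f X + f Y) *
  (forall a X, f (a *: X) = a *: f X).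
Proof.
move=> lf; pose f' : {linear V -> V} := HB.pack f (GRing.isLinear.Build C V V *:%R f lf).
split; [split|] => *; [exact: (raddfB f') | exact: (raddfD f') | exact: (linearZ_LR f')].
Qed.

(** * Depolarizing channels and depolarized circuits *)

Lemma channel_depolarizing n (p : R) : (0 < n)%N -> 0 <= p <= 1 ->
  channel (@depolarizing R n p).
Proof.
move=> n0 /andP[p0 p1]; split.
- move=> a X Y; rewrite /depolarizing mxtraceD mxtraceZ.
  by rewrite !scalerDr mulrDr scalerDl !scalerA [a * (1 - p)%:C]mulrC mulrCA addrACA.
- move=> k X pX; rewrite /ampliation /depolarizing mxblockD => v.
  rewrite mulmxDr mulmxDl mxE addr_ge0 //.
    have -> : \mxblock_(i < k, j < k) ((1 - p)%:C *: submxblock X i j) =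
        (1 - p)%:C *: X.
      by rewrite -[in RHS](submxblockK X); apply/matrixP => i j; rewrite !mxE.
    by apply: psdZ => //; rewrite lecR subr_ge0.
  (* The ampliated reset part is a nonnegative multiple of the matrix of block traces tensored with
     the identity. *)
  have -> : \mxblock_(i < k, j < k) ((p%:C * \tr (submxblock X i j)) *: (n%:R^-1)%:M : 'M[C]_n)
     = (p%:C * n%:R^-1) *: \mxblock_(i < k, j < k) ((\tr (submxblock X i j))%:M : 'M[C]_n).
    by apply/matrixP => i j; rewrite !mxE !mulrnAr mulrAC.
  apply: psdZ; first by rewrite mulr_ge0 ?lecR // invr_ge0 ler0n.
  by apply: psd_mxblock_tr; rewrite submxblockK.
- move=> X; rewrite /depolarizing mxtraceD !mxtraceZ mxtrace_scalar.
  rewrite -[_^-1 *+ n]mulr_natr mulVf ?pnatr_eq0 -?lt0n //.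
  by rewrite rmorphB rmorph1; ring.
Qed.

(* The reset part [tau] need not be [p I / D] once channels are applied after the
   noise, but on states it still dominates [p / D] times every output of [Psi]. *)
Definition depolarized n (p : R) (Phi : 'M[C]_n -> 'M[C]_n) : Prop :=
  exists Psi tau, [/\ channel Psi,
    forall X, Phi X = (1 - p)%:C *: Psi X + \tr X *: tau
  & forall X, psd X -> psd (\tr X *: tau - (p / n%:R)%:C *: Psi X)].

Lemma depolarized_id n : depolarized 0 (@id 'M[C]_n).
Proof.
exists id, 0; split; first exact: channel_id.
- by move=> X; rewrite subr0 scale1r scaler0 addr0.
- by move=> X pX; rewrite mul0r scale0r subr0 scaler0; exact: psd0.
Qed.

Lemma depolarized_step n (p q : R) (Phi Psi : 'M[C]_n -> 'M[C]_n) :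
  0 <= q <= 1 -> channel Psi -> trace_preserving Phi -> depolarized p Phi ->
  depolarized (1 - (1 - p) * (1 - q)) (fun X => depolarizing q (Psi (Phi X))).
Proof.
move=> /andP[q0 q1] chPsi tPhi [Phi0 [tau [chPhi0 PhiE tau_dom]]].
have [lPsi cPsi tPsi] := chPsi; have [_ _ tPhi0] := chPhi0.
have chPsi0 := channel_comp chPsi chPhi0.
(* The old reset operator passes through [Psi] and is damped by [1 - q]; the new noise adds
   [q I / n]. *)
exists (Psi \o Phi0), ((1 - q)%:C *: Psi tau + (q / n%:R)%:C%:M); split=> [//|X|X pX].
  rewrite /depolarizing tPsi tPhi PhiE !(linear_morph lPsi) /=.
  apply/matrixP => i j; rewrite !mxE.
  rewrite !(rmorphM, rmorphB, rmorph1) /= fmorphV rmorph_nat; ring.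
(* The coefficient splits as [(1 - q) p / n + q / n]: the first share is dominated by the image of
   the old domination under [Psi], the second by the identity scaled by the trace. *)
have -> : \tr X *: ((1 - q)%:C *: Psi tau + (q / n%:R)%:C%:M) -
    ((1 - (1 - p) * (1 - q)) / n%:R)%:C *: (Psi \o Phi0) X =
    (1 - q)%:C *: Psi (\tr X *: tau - (p / n%:R)%:C *: Phi0 X) +
    (q / n%:R)%:C *: ((\tr (Psi (Phi0 X)))%:M - Psi (Phi0 X)).
  rewrite tPsi tPhi0 !(linear_morph lPsi) /=.
  apply/matrixP => i j; rewrite !mxE.
  rewrite !(rmorphM, rmorphB, rmorph1) /=; ring.
apply: psdD; apply: psdZ.
- by rewrite lecR subr_ge0.
- exact/(completely_positive_psd cPsi)/tau_dom.
- by rewrite lecR divr_ge0.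
- apply: psd_le_mxtrace; have [_ + _] := chPsi0.
  by move=> /completely_positive_psd; apply.
Qed.

Lemma depolarized_foldl n (I : Type) (Cs : I -> 'M[C]_n -> 'M[C]_n) (p : I -> R) s :
  (0 < n)%N -> (forall i, channel (Cs i)) -> (forall i, 0 <= p i <= 1) ->
  let Phi := foldl (fun Y i => depolarizing (p i) (Cs i Y)) ^~ s in
  channel Phi /\ depolarized (1 - \prod_(i <- s) (1 - p i)) Phi.
Proof.
(* Induction from the end of the list, as [foldl] applies its last element outermost. *)
move=> n0 chCs p01 /=; elim/last_ind: s => [|s i [chPhi dPhi]].
  rewrite big_nil subrr; split; [exact: channel_id | exact: depolarized_id].
rewrite big_rcons /=.
have -> : foldl (fun Y i => depolarizing (p i) (Cs i Y)) ^~ (rcons s i) =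
    fun X => depolarizing (p i)
      (Cs i (foldl (fun Y i => depolarizing (p i) (Cs i Y)) X s)).
  by apply/funext => X; rewrite foldl_rcons.
split.
  apply: channel_comp (channel_depolarizing n0 (p01 i)) _.
  exact: channel_comp (chCs i) chPhi.
have := depolarized_step (p01 i) (chCs i) (let: And3 _ _ tPhi := chPhi in tPhi) dPhi.
by rewrite subKr.
Qed.

(** * The privacy bound *)

(** Here [c], [t] and [T] stand for [Tr (M Psi P)], [Tr (M tau)] and [Tr P]. With [q = c / T] in
    [[0, 1]], the loss is at most [q] times the second argument of the maximum, hence at most the
    maximum. *)
Lemma privacy_loss_bound (e p kappa N c t T : R) : 0 <= e -> 0 <= p <= 1 ->
  0 <= c <= T -> T <= kappa -> 0 <= t -> p / N * c <= T * t ->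
  (1 - p) * c + (1 - expR e) * t <= Num.max 0 ((1 - expR e) * (p / N) + (1 - p) * kappa).
Proof.
move=> e0 /andP[p0 p1] /andP[c0 cT] Tk t0 pct.
have e1 : 1 <= expR e by rewrite -expR0 ler_expR.
set d := _ + _ * kappa.
(* For [T = 0] the ratio [c / T] is meaningless, but [c] vanishes and what remains is
   nonpositive. *)
have [T0|T_gt0] := leP T 0.
  have -> : c = 0 by apply/le_anti; rewrite c0 (le_trans cT).
  by rewrite mulr0 add0r le_max mulr_le0_ge0 ?subr_le0.
apply: (@le_trans _ _ (c / T * Num.max 0 d)); last first.
  by rewrite ler_piMl ?le_max ?lexx // ler_pdivrMr ?mul1r.
apply: (@le_trans _ _ (c / T * d)); last first.
  by rewrite ler_wpM2l ?divr_ge0 ?(ltW T_gt0) // le_max lexx orbT.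
rewrite /d mulrDr [leRHS]addrC lerD //.
  rewrite mulrCA ler_wpM2l ?subr_ge0 // mulrAC ler_pdivlMr //.
  by rewrite ler_wpM2l.
(* The factor [1 - expR e] is nonpositive, so the lower bound on [t] becomes an upper bound. *)
rewrite mulrCA ler_wnM2l ?subr_le0 //.
by rewrite mulrAC ler_pdivrMr // mulrC [leRHS]mulrC.
Qed.

Lemma depolarized_private n (p eps kappa : R) (Phi : 'M[C]_n -> 'M[C]_n) :
  0 <= eps -> 0 <= p <= 1 -> channel Phi -> depolarized p Phi ->
  differentially_private (@neighbouring R kappa n) eps
    (Num.max 0 ((1 - expR eps) * (p / n%:R) + (1 - p) * kappa)) Phi.
Proof.
move=> eps0 p01 chPhi [Psi [tau [chPsi PhiE tau_dom]]].
split=> [|M rho sigma]; first exact: chPhi.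
rewrite /loewner_le subr0 => pM pM1 [prho trho] [psigma tsigma] nb.
have [lPsi cPsi tPsi] := chPsi.
have [P [pP pN trP]] : exists P, [/\ psd P, psd (P - (rho - sigma))
    & \tr P = 2^-1 * (trace_norm (rho - sigma) + \tr (rho - sigma))].
  by apply: psd_jordan; rewrite linearB /= map_mxB !psd_adj.
(* The difference of two states is traceless, so [Tr P] is half its trace norm. *)
rewrite mxtraceB trho tsigma subrr addr0 in trP.
have pPsi X : psd X -> psd (Psi X) by exact: completely_positive_psd.
have real_part (z : C) : 0 <= z -> exists2 r : R, 0 <= r & z = r%:C.
  by case: z => [x y]; rewrite lecE /= => /andP[/eqP -> x0]; exists x.
have [r r0 er] := real_part _ (psd_tr_mul_ge0 pM (pPsi _ prho)).
have [s s0 es] := real_part _ (psd_tr_mul_ge0 pM (pPsi _ psigma)).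
have [c c0 ec] := real_part _ (psd_tr_mul_ge0 pM (pPsi _ pP)).
have [T T0 eT] := real_part _ (psd_tr_ge0 pP).
have trM X : psd X -> (p / n%:R)%:C * \tr (M *m Psi X) <= \tr X * \tr (M *m tau).
  move=> pX; have := psd_tr_mul_ge0 pM (tau_dom _ pX).
  by rewrite mulmxBr mxtraceB -!scalemxAr !mxtraceZ subr_ge0.
(* The domination at [rho] shows that [Tr (M tau)] is real and nonnegative. *)
have [t t0 et] : exists2 t : R, 0 <= t & \tr (M *m tau) = t%:C.
  apply: real_part; have := trM _ prho; rewrite trho mul1r; apply: le_trans.
  rewrite er mulr_ge0 // lecR // divr_ge0 //; by case/andP: p01.
have cT : c <= T.
  have := psd_tr_mul_ge0 pM1 (pPsi _ pP).
  by rewrite mulmxBl mxtraceB mul1mx tPsi ec eT subr_ge0 lecR.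
have Tk : T <= kappa by move: nb; rewrite /neighbouring -trP eT lecR.
have pct : p / n%:R * c <= T * t.
  by have := trM _ pP; rewrite ec eT et -!rmorphM /= lecR.
(* Positivity of [Psi] on the negative part [P - (rho - sigma)]. *)
have rsc : r - s <= c.
  have := psd_tr_mul_ge0 pM (pPsi _ pN); rewrite !(linear_morph lPsi) !mulmxBr.
  by rewrite !mxtraceB er es ec -!rmorphB lecR subr_ge0.
have trPhi X : \tr (M *m Phi X) =
    (1 - p)%:C * \tr (M *m Psi X) + \tr X * \tr (M *m tau).
  by rewrite PhiE mulmxDr -!scalemxAr mxtraceD !mxtraceZ.
have es1 : 1 <= expR eps by rewrite -expR0 ler_expR.
rewrite !trPhi trho tsigma !mul1r er es et.
rewrite -!rmorphM -!rmorphD -rmorphM -rmorphD /= lecR -lerBlDl.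
apply: le_trans (privacy_loss_bound eps0 p01 _ Tk t0 pct); last by rewrite c0.
have /andP[p0 p1] := p01.
have : (1 - p) * (r - s) <= (1 - p) * c by rewrite ler_wpM2l // subr_ge0.
(* This term is the slack from replacing [expR eps] by 1 in front of [(1 - p) * s]. *)
have : 0 <= (1 - p) * s * (expR eps - 1) by rewrite !mulr_ge0 // subr_ge0.
lra.
Qed.

End Channels.

Theorem mainTheorem6 (R : realType) (D : nat) (eps kappa : R) :
  (0 < D)%N -> 0 <= eps -> 0 <= kappa ->
  (forall p : R, 0 <= p <= 1 ->
    differentially_private (@neighbouring R kappa D) eps
      (Num.max 0 ((1 - expR eps) * (p / D%:R) + (1 - p) * kappa))
      (@depolarizing R D p)) /\
  (forall (n : nat) (Cs : 'I_n -> 'M[R[i]]_D -> 'M[R[i]]_D) (p : 'I_n -> R),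
    (forall i, channel (Cs i)) -> (forall i, 0 <= p i <= 1) ->
    let pstar := 1 - \prod_(i < n) (1 - p i) in
    differentially_private (@neighbouring R kappa D) eps
      (Num.max 0 ((1 - expR eps) * (pstar / D%:R) + (1 - pstar) * kappa))
      (noisy_circuit Cs p)).
Proof.
move=> D0 eps0 _; split=> [p p01|n Cs p chCs p01 pstar].
  apply: (depolarized_private kappa eps0 p01 (channel_depolarizing D0 p01)).
  (* A single depolarization is one step from the identity, with parameter
     [1 - (1 - 0)(1 - p) = p]. *)
  have := depolarized_step p01 (channel_id _ D) (fun=> erefl) (depolarized_id _ D).
  by rewrite subr0 mul1r subKr.
have [chPhi dPhi] := depolarized_foldl (enum 'I_n) D0 chCs p01.
rewrite big_enum /= -/pstar in dPhi.
apply: (depolarized_private kappa eps0 _ chPhi dPhi).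
(* It remains to see that [pstar] lies in [[0, 1]]. *)
have q01 i : 0 <= 1 - p i <= 1.
  by have /andP[p0 p1] := p01 i; rewrite subr_ge0 p1 gerBl.
rewrite /pstar subr_ge0 gerBl prodr_ile1 => [|i _]; last exact: q01.
by rewrite prodr_ge0 // => i _; have /andP[] := q01 i.
Qed.
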